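(* Let $f\in\mathcal S^0_{\mu_f}(\mathcal X)$ with $\mu_f\ge 0$ and $g\in\mathcal S^0_{\mu_g}(\mathcal Y)$ with $\mu_g\ge 0$. Let $\{\beta_k\}_{k\ge1}$ be a positive nondecreasing sequence with $\lim_{k\to+\infty}\beta_k=+\infty$, let $\{\alpha_k\}_{k\ge1}$ be a positive sequence, and suppose that $\delta,\gamma>0$ satisfy, for every $k\ge 1$, $$\delta\gamma-1\ge 0,\qquad \delta\beta_{k+1}\le \delta\beta_k+\alpha_k\beta_k,\qquad \|B\|^2(\alpha_{k+1}^2\beta_{k+1}^2-\alpha_k^2\beta_k^2)\le\alpha_k\beta_k\mu_g .$$ Let $\{(x_k,y_k,\lambda_k)\}_{k\ge1}$ be the sequence generated by the Primal-dual Splitting Algorithm (defined in the context), and let $(x^*,y^*,\lambda^* )\in\Omega$ (so $\Omega\neq\emptyset$). Assume that $\{\epsilon_k\}_{k\ge1}$ is a nonincreasing sequence of nonnegative numbers satisfying $\sum_{k=1}^{+\infty}\alpha_k\epsilon_k<+\infty$ and $\lim_{k\to+\infty}\beta_k\epsilon_k=+\infty$. Let $(\bar x^*,\bar y^* )$ be the element of minimal norm of the solution set $\mathbb S$. Then $$\liminf_{k\to+\infty}\|(x_k,y_k)-(\bar x^*,\bar y^* )\|=0 .$$ Further, if there exists an integer $K\ge1$ such that the sequence $\{(x_k,y_k)\}_{k\ge K}$ stays in either the open ball $B\big(0,\sqrt{\|\bar x^*\|^2+\|\bar y^*\|^2}\big)$ of $\mathcal X\times\mathcal Y$ or its complement,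 then $$\lim_{k\to+\infty}\|(x_k,y_k)-(\bar x^*,\bar y^* )\|=0 .$$
   Context: $\mathcal X,\mathcal Y,\mathcal Z$ are real Hilbert spaces; $\mathcal X\times\mathcal Y$ carries the product norm $\|(x,y)\|^2=\|x\|^2+\|y\|^2$. The problem is $\min_{x\in\mathcal X,y\in\mathcal Y}\Phi(x,y):=f(x)+g(y)$ subject to $Ax+By=b$, where $f:\mathcal X\to\mathbb R\cup\{+\infty\}$, $g:\mathcal Y\to\mathbb R\cup\{+\infty\}$ are proper, convex, lower semicontinuous, $A:\mathcal X\to\mathcal Z$, $B:\mathcal Y\to\mathcal Z$ are continuous linear operators, $b\in\mathcal Z$, and the set $\mathbb S$ of optimal solutions is nonempty. $(\bar x^*,\bar y^* )=\mathrm{proj}_{\mathbb S}0$, where $\mathrm{proj}$ is the metric projection. $\mathcal S^0_\mu(\mathcal X)$ ($\mu\ge0$) is the set of proper, closed, lower semicontinuous convex functions $f$ on $\mathcal X$ such that $f(x_1)-f(x_2)-\langle w,x_1-x_2\rangle\ge\frac\mu2\|x_1-x_2\|^2$ for all $x_1,x_2\in\mathcal X$ and $w\in\partial f(x_2)$ (convex subdifferential); similarly for $\mathcal Y$. Lagrangian: $\mathcal L(x,y,\lambda)=f(x)+g(y)+\langle\lambda,Ax+By-b\rangle$. Augmented Lagrangian: $\mathcal L_\theta(x,y,\lambda)=\mathcal L(x,y,\lambda)+\frac\theta2\|Ax+By-b\|^2$. $\Omega$ is the set of saddle points: $(x^*,y^*,\lambda^* )\in\Omega$ iff $\mathcal L(x^*,y^*,\lambda)\le\mathcal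 L(x^*,y^*,\lambda^* )\le\mathcal L(x,y,\lambda^* )$ for all $(x,y,\lambda)\in\mathcal X\times\mathcal Y\times\mathcal Z$. Primal-dual Splitting Algorithm. Parameters: $\delta>0$, $\gamma>0$, sequences $\alpha_k>0$, $\beta_k>0$, $\epsilon_k\ge0$. Initialize $x_1=x_0=\frac1\gamma Z_1$, $y_1=y_0=\frac1\gamma H_1$, $\lambda_1=\lambda_0$. For $k=1,2,\dots$: Step 1: $\theta_k=(\alpha_k+\delta)\beta_k$, $\eta_{f,k}=\gamma+\frac1{\alpha_k}+\mu_f\delta\beta_k$, $\widetilde\lambda_{1,k}=\lambda_k-\delta\beta_k(Ax_k+By_k-b)+\delta\alpha_k\beta_kB(H_k-\gamma y_k)$, $\widetilde x_k=x_k+\frac{Z_k-\gamma x_k}{\eta_{f,k}}$, $$x_{k+1}=\arg\min_{x\in\mathcal X}\Big(\mathcal L_{\theta_k}(x,y_k,\widetilde\lambda_{1,k})+\frac{\eta_{f,k}}{2\alpha_k\beta_k}\|x-\widetilde x_k\|^2+\frac{\epsilon_k}2\|x\|^2\Big),$$ $Z_{k+1}=\frac{x_{k+1}-x_k}{\alpha_k}+\gamma x_{k+1}$, $Z^\delta_{k+1}=\delta Z_{k+1}+(1-\delta\gamma)x_{k+1}$. Step 2: $\eta_{g,k}=\gamma+\frac1{\alpha_k}+\mu_g\delta\beta_k$, $\widetilde\lambda_{2,k}=\lambda_k-\delta\beta_k(Ax_k+By_k-b)$, $\widetilde y_k=y_k+\frac{H_k-\gamma y_k}{\eta_{g,k}}$,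 $$y_{k+1}=\arg\min_{y\in\mathcal Y}\Big(\mathcal L_{\theta_k}(x_{k+1},y,\widetilde\lambda_{2,k})+\frac{\eta_{g,k}}{2\alpha_k\beta_k}\|y-\widetilde y_k\|^2+\frac{\epsilon_k}2\|y\|^2\Big),$$ $H_{k+1}=\frac{y_{k+1}-y_k}{\alpha_k}+\gamma y_{k+1}$, $H^\delta_{k+1}=\delta H_{k+1}+(1-\delta\gamma)y_{k+1}$. Step 3: $\lambda_{k+1}=\lambda_k+\alpha_k\beta_k(AZ^\delta_{k+1}+BH^\delta_{k+1}-b)$. *)

(* Defs.v *)
From HB Require Import structures.
From mathcomp Require Import all_boot all_order all_algebra.
From mathcomp Require Import sesquilinear.
From mathcomp Require Import all_classical all_reals all_analysis.

Set Implicit Arguments.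
Unset Strict Implicit.
Unset Printing Implicit Defensive.

Import Order.TTheory GRing.Theory Num.Theory.
Import numFieldNormedType.Exports.

Local Open Scope classical_set_scope.
Local Open Scope ring_scope.

HB.mixin Record CompleteNormedModule_isHilbert (R : realType) X
    of CompleteNormedModule R X := {
  inner : {dot X for (@idfun R)};
  inner_norm : forall x : X, inner x x = `|x| ^+ 2
}.

#[short(type="hilbertType")]
HB.structure Definition Hilbert (R : realType) :=
  {X of CompleteNormedModule R X & CompleteNormedModule_isHilbert R X}.

Notation "''<' u , v >" := (inner u v)
  (at level 8, u, v at level 69, format "''<' u ,  v >") :
  ring_scope.

Section ConvexAnalysis.
Context {R : realType} {X : hilbertType R}.
Implicit Type f : X -> \bar R.

Definition proper_fun f :=
  (forall x, (-oo < f x)%E) /\ (exists x, (f x < +oo)%E).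

Definition closed_fun f := closed [set p : X * R | (f p.1 <= p.2%:E)%E].

Definition convex_fun f := forall (x y : X) (t : R), 0 < t -> t < 1 ->
  (f (t *: x + (1 - t) *: y)%R <= t%:E * f x + (1 - t)%:E * f y)%E.

Definition subdiff f (x : X) : set X :=
  [set w | forall y, (f x + '<w, y - x>%:E <= f y)%E].

(* If f x2 = +oo for a proper f, then subdiff f x2 is empty; hence f x2 is
   finite in the last clause and the extended-real difference is meaningful. *)
Definition S0 (mu : R) f :=
  [/\ proper_fun f, closed_fun f, lower_semicontinuous f, convex_fun f &
      forall x1 x2 w, subdiff f x2 w ->
        ((mu / 2 * `|x1 - x2| ^+ 2)%:E <=
          f x1 - f x2 - '<w, x1 - x2>%:E)%E].

End ConvexAnalysis.

(* A minimizer must have a finite value: the argmin of a function that is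
   identically +oo on D is empty. *)
Definition argmin {R : realType} {T : Type} (D : set T) (F : T -> \bar R) :
    set T :=
  [set x | [/\ D x, (F x < +oo)%E & forall y, D y -> (F x <= F y)%E]].

Section ProductSpace.
Context {R : realType} {X Y : hilbertType R}.

(* The canonical norm of the library on X * Y is the maximum norm; this is the
   Hilbert one. *)
Definition pnorm (p : X * Y) : R := Num.sqrt (`|p.1| ^+ 2 + `|p.2| ^+ 2).

Definition pball (c : X * Y) (r : R) : set (X * Y) :=
  [set p | pnorm (p - c) < r].

(* [is_proj C u p] : p is the metric projection of u onto C. *)
Definition is_proj (C : set (X * Y)) (u p : X * Y) :=
  C p /\ forall q, C q -> pnorm (p - u) <= pnorm (q - u).

End ProductSpace.

Definition opnorm {R : realType} {X Y : hilbertType R} (B : X -> Y) : R :=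
  sup [set `|B x| | x in [set x : X | `|x| <= 1]].

Section Problem.
Context {R : realType} {X Y Z : hilbertType R}.
Variables (f : X -> \bar R) (g : Y -> \bar R).
Variables (A : X -> Z) (B : Y -> Z) (b : Z).

Definition objective (p : X * Y) : \bar R := (f p.1 + g p.2)%E.

Definition feasible : set (X * Y) := [set p | A p.1 + B p.2 = b].

Definition solutions : set (X * Y) := argmin feasible objective.

Definition lagr (x : X) (y : Y) (lam : Z) : \bar R :=
  (f x + g y + '<lam, A x + B y - b>%:E)%E.

Definition aug_lagr (theta : R) (x : X) (y : Y) (lam : Z) : \bar R :=
  (lagr x y lam + (theta / 2 * `|A x + B y - b| ^+ 2)%:E)%E.

Definition saddle (xs : X) (ys : Y) (lams : Z) :=
  forall x y lam, (lagr xs ys lam <= lagr xs ys lams)%E /\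
                  (lagr xs ys lams <= lagr x y lams)%E.

Variables (mu_f mu_g delta gamma : R) (alpha beta eps : nat -> R).

(* Zs and Hs are the auxiliary sequences Z_k and H_k. The entries of Zs, Hs,
   alpha, beta, eps at index 0 are irrelevant. *)
Section Iterates.
Variables (x Zs : nat -> X) (y Hs : nat -> Y) (lam : nat -> Z).

Definition theta k := (alpha k + delta) * beta k.
Definition eta (mu : R) k := gamma + (alpha k)^-1 + mu * delta * beta k.
Definition resid k : Z := A (x k) + B (y k) - b.

Definition lam1 k : Z :=
  lam k - (delta * beta k) *: resid k
  + (delta * alpha k * beta k) *: B (Hs k - gamma *: y k).
Definition lam2 k : Z := lam k - (delta * beta k) *: resid k.

Definition xtilde k : X := x k + (eta mu_f k)^-1 *: (Zs k - gamma *: x k).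
Definition ytilde k : Y := y k + (eta mu_g k)^-1 *: (Hs k - gamma *: y k).

Definition x_subproblem k (u : X) : \bar R :=
  (aug_lagr (theta k) u (y k) (lam1 k)
   + (eta mu_f k / (2 * alpha k * beta k) * `|u - xtilde k| ^+ 2)%:E
   + (eps k / 2 * `|u| ^+ 2)%:E)%E.

Definition y_subproblem k (v : Y) : \bar R :=
  (aug_lagr (theta k) (x k.+1) v (lam2 k)
   + (eta mu_g k / (2 * alpha k * beta k) * `|v - ytilde k| ^+ 2)%:E
   + (eps k / 2 * `|v| ^+ 2)%:E)%E.

Definition Zdelta k : X := delta *: Zs k + (1 - delta * gamma) *: x k.
Definition Hdelta k : Y := delta *: Hs k + (1 - delta * gamma) *: y k.

Record pds_algorithm : Prop := PdsAlgorithm {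
  pds_x0 : x 0 = gamma^-1 *: Zs 1;
  pds_x1 : x 1 = x 0;
  pds_y0 : y 0 = gamma^-1 *: Hs 1;
  pds_y1 : y 1 = y 0;
  pds_lam1 : lam 1 = lam 0;
  pds_x : forall k, (1 <= k)%N -> argmin setT (x_subproblem k) (x k.+1);
  pds_Z : forall k, (1 <= k)%N ->
    Zs k.+1 = (alpha k)^-1 *: (x k.+1 - x k) + gamma *: x k.+1;
  pds_y : forall k, (1 <= k)%N -> argmin setT (y_subproblem k) (y k.+1);
  pds_H : forall k, (1 <= k)%N ->
    Hs k.+1 = (alpha k)^-1 *: (y k.+1 - y k) + gamma *: y k.+1;
  pds_lam : forall k, (1 <= k)%N ->
    lam k.+1 = lam k + (alpha k * beta k) *:
                 (A (Zdelta k.+1) + B (Hdelta k.+1) - b)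
}.

End Iterates.
End Problem.

(* Main.v *)
Require Import Defs.
From mathcomp Require Import all_boot all_order all_algebra.
From mathcomp Require Import sesquilinear.
From mathcomp Require Import all_classical all_reals all_analysis.
From mathcomp Require Import ring lra.

(* Write u_k = Z^delta_k, w_k = H^delta_k and p_k = (x_k, y_k).  Substituting
   the definitions of the algorithm, the optimality conditions of the two
   subproblems become inclusions in which the multipliers are lambda_{k+1} for y
   and lambda_{k+1} - alpha_k beta_k B(w_{k+1} - w_k) for x.  Testing them at
   u_{k+1} - xbar and w_{k+1} - ybar shows that the energy
     delta beta_k (L(p_k, lambda_star) - L_star
                   + eps_k/2 (|p_k|^2 - |pbar|^2)) + R_k
   does not increase, where R_k >= 0 collects |(u_k, w_k) - pbar|^2,
   |p_k - pbar|^2, |lambda_k - lambda_star|^2 and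
   (alpha_k beta_k)^2 |B(w_k - ybar)|^2 with suitable weights.
   A Kronecker argument with sum alpha_k eps_k < oo makes the energy without
   the -|pbar|^2 term o(beta_k); hence the Lagrangian gap tends to 0, and so
   does the constraint residual, because delta beta_k (A x_k + B y_k - b) is
   lambda_k minus a convex average of earlier multipliers and a fixed vector.
   If the iterates eventually stay outside the ball of radius |pbar|, the energy
   is nonnegative and bounded, so beta_k eps_k -> oo forces |p_k| -> |pbar|;
   inside the ball limsup |p_k| <= |pbar| is automatic.  Finally the minimal
   norm problem is Tikhonov well-posed: an almost feasible, almost optimal point
   whose norm barely exceeds |pbar| is close to pbar. *)

Set Implicit Arguments.
Unset Strict Implicit.
Unset Printing Implicit Defensive.

Import Order.TTheory GRing.Theory Num.Theory.
Import numFieldNormedType.Exports.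

Local Open Scope classical_set_scope.
Local Open Scope ring_scope.

(** * Inner products and the Riesz representation *)

Section InnerProduct.
Context {R : realType} {X : hilbertType R}.
Implicit Types (u v w : X) (a : R).

Lemma innerC u v : '<u, v> = '<v, u>.
Proof. by rewrite hermC expr0 mul1r. Qed.

Lemma innerDl u v w : '<u + v, w> = '<u, w> + '<v, w>.
Proof. exact: linearDl. Qed.

Lemma innerDr u v w : '<w, u + v> = '<w, u> + '<w, v>.
Proof. exact: linearDr. Qed.

Lemma innerNl u v : '<- u, v> = - '<u, v>.
Proof. exact: linearNl. Qed.

Lemma innerNr u v : '<u, - v> = - '<u, v>.
Proof. exact: linearNr. Qed.

Lemma innerZl a u v : '<a *: u, v> = a * '<u, v>.
Proof. exact: linearZl_LR. Qed.

Lemma innerZr a u v : '<u, a *: v> = a * '<u, v>.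
Proof. by rewrite innerC innerZl innerC. Qed.

Lemma inner0l u : '<0, u> = 0.
Proof. exact: linear0l. Qed.

Definition innerE := (innerDl, innerDr, innerNl, innerNr, innerZl, innerZr).

Lemma inner_ext u v : (forall w, '<u, w> = '<v, w>) -> u = v.
Proof.
move=> uv; apply/eqP; rewrite -subr_eq0 -normr_eq0 -sqrf_eq0 -inner_norm.
by rewrite innerDl innerNl uv subrr.
Qed.

Lemma parallelogram u v :
  `|u - v| ^+ 2 = 2 * `|u| ^+ 2 + 2 * `|v| ^+ 2 - 4 * `|2^-1 *: (u + v)| ^+ 2.
Proof. by rewrite -!inner_norm !innerE (innerC v u); field. Qed.

Lemma sqr_inner_le u v : '<u, v> ^+ 2 <= `|u| ^+ 2 * `|v| ^+ 2.
Proof.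
have [->|v0] := eqVneq v 0.
  by rewrite innerC inner0l expr0n /= mulr_ge0// sqr_ge0.
have v2 : 0 < `|v| ^+ 2 by rewrite exprn_gt0// normr_gt0.
have := sqr_ge0 (`| `|v| ^+ 2 *: u - '<u, v> *: v|).
rewrite -inner_norm !innerE (innerC v u) !inner_norm => h.
have : 0 <= `|v| ^+ 2 * (`|u| ^+ 2 * `|v| ^+ 2 - '<u, v> ^+ 2).
  by apply: le_trans h _; rewrite le_eqVlt; apply/orP; left; apply/eqP; ring.
by rewrite pmulr_rge0// subr_ge0.
Qed.

Lemma norm_inner_le u v : `|'<u, v>| <= `|u| * `|v|.
Proof.
rewrite -ler_sqr ?nnegrE ?mulr_ge0// exprMn -normrX ger0_norm ?sqr_ge0//.
exact: sqr_inner_le.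
Qed.

(** Stated with squares because the parallelogram law bounds squared distances along the minimizing
    sequences used below. *)
Lemma cvgn_sqr_cauchy (u : nat -> X) (e : nat -> R) :
  e @ \oo --> 0 ->
  (forall n m, (n <= m)%N -> `|u m - u n| ^+ 2 <= e n) -> cvgn u.
Proof.
move=> e0 ue; apply/cauchy_cvgP/cauchyP => d d0.
have [N _ eN] : \forall n \near \oo, e n < d ^+ 2.
  move/cvgrPdist_lt: e0 => /(_ _ (exprn_gt0 2 d0)); apply: filterS => n.
  by rewrite sub0r normrN; exact: le_lt_trans (ler_norm _).
exists (u N); exists N => // m /= Nm.
rewrite -ball_normE /= distrC -ltr_sqr ?nnegrE ?normr_ge0// ?ltW//.
by apply: le_lt_trans (ue _ _ Nm) _; exact: (eN N (leqnn N)).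
Qed.

Lemma cvg_innerl (u : nat -> X) w h :
  u @ \oo --> w -> (fun n => '<u n, h>) @ \oo --> '<w, h>.
Proof.
move=> uw; apply/cvgrPdist_le => e e0.
have h0 : 0 < `|h| + 1 by rewrite ltr_wpDl.
have /cvgrPdist_le/(_ (e / (`|h| + 1))) := uw.
move=> /(_ (divr_gt0 e0 h0)); apply: filterS => n.
rewrite -innerNl -innerDl ler_pdivlMr// => le_e.
apply: le_trans (norm_inner_le _ _) _; apply: le_trans le_e.
by rewrite ler_wpM2l// lerDl.
Qed.

Lemma scalarD (M : X -> R) :
  scalar M -> forall u v, M (u + v) = M u + M v.
Proof. by move=> ML u v; have := ML 1 u v; rewrite scale1r mul1r. Qed.

Lemma scalarZ (M : X -> R) :
  scalar M -> forall a u, M (a *: u) = a * M u.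
Proof.
move=> ML a u; have M0 : M 0 = 0.
  have := scalarD ML 0 0; rewrite addr0 => /eqP.
  by rewrite -subr_eq subrr => /eqP.
by have := ML a u 0; rewrite !addr0 M0 addr0.
Qed.

Lemma scalarN (M : X -> R) :
  scalar M -> forall u, M (- u) = - M u.
Proof. by move=> ML u; rewrite -scaleN1r scalarZ// mulN1r. Qed.

(** The representer is the minimizer of [J u = |u|^2 / 2 - phi u]: a minimizing sequence is Cauchy
    by the parallelogram law, and the first-order condition at its limit reads ['<w, h> = phi h]. *)
Lemma riesz_representation (phi : X -> R) (C : R) :
  scalar phi -> (forall u, `|phi u| <= C * `|u|) ->
  exists w, forall u, '<w, u> = phi u.
Proof.
move=> phiL phiC.
have phiD := scalarD phiL; have phiZ := scalarZ phiL.
pose J u : R := 2^-1 * `|u| ^+ 2 - phi u.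
have JD u h : J (u + h) = J u + ('<u, h> - phi h) + 2^-1 * `|h| ^+ 2.
  by rewrite /J -!inner_norm !innerE (innerC h u) phiD; field.
have Jlb : has_inf (range J).
  split; first by exists (J 0), 0.
  exists (- (2^-1 * C ^+ 2)) => _ [u _ <-]; rewrite /J.
  have := le_trans (ler_norm _) (phiC u); have := sqr_ge0 (`|u| - C); nra.
pose j : R := inf (range J).
have jJ u : j <= J u by apply: ge_inf; [exact: Jlb.2 | exists u].
have /choice[u uj] : forall n : nat, exists u, J u <= j + n.+1%:R^-1.
  move=> n.
  have [|_ [u _ <-] Ju] := @inf_adherent _ (range J) (n.+1%:R^-1) _ Jlb.
    by rewrite invr_gt0.
  by exists u; exact: ltW.
have inv0 : (fun n : nat => n.+1%:R^-1 : R) @ \oo --> 0 by exact: cvg_harmonic.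
have cu : cvgn u.
  (* In [4 J(u m) + 4 J(u n) - 8 J(midpoint)] the linear terms cancel, leaving [|u m - u n|^2]. The
     first two values exceed [j] by at most [1/(n+1)] each and the last is at least [j], whence the
     8. *)
  apply: (@cvgn_sqr_cauchy _ (fun n => 8 * n.+1%:R^-1)).
    rewrite -(mulr0 8); exact: cvgMr.
  move=> n m nm; rewrite parallelogram.
  have := jJ (2^-1 *: (u m + u n)); rewrite {1}/J phiZ phiD.
  have := uj n; have := uj m; rewrite /J.
  have : m.+1%:R^-1 <= n.+1%:R^-1 :> R by rewrite lef_pV2 ?posrE// ler_nat ltnS.
  move: (n.+1%:R^-1 : R) (m.+1%:R^-1 : R) => a c; lra.
exists (limn u) => h.
(* [J] is expanded around [u n], so that only the inner product has to pass to the limit. *)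
have step t : 0 <= t * ('<limn u, h> - phi h) + t ^+ 2 * (2^-1 * `|h| ^+ 2).
  have cL : (fun n => t * ('<u n, h> - phi h) + t ^+ 2 * (2^-1 * `|h| ^+ 2)
      + n.+1%:R^-1) @ \oo -->
      t * ('<limn u, h> - phi h) + t ^+ 2 * (2^-1 * `|h| ^+ 2) + 0.
    apply: cvgD => //; apply: cvgD; last exact: cvg_cst.
    apply: cvgMr; apply: cvgD; last exact: cvg_cst.
    exact: cvg_innerl.
  rewrite addr0 in cL; apply: (cvgr_to_ge cL).
  near=> n; have := jJ (u n + t *: h); have := uj n; rewrite JD innerZr phiZ.
  rewrite normrZ exprMn real_normK ?num_real//.
  move: (n.+1%:R^-1 : R) => a; lra.
apply/eqP; rewrite -subr_eq0; set d := _ - _ in step *.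
set q := 2^-1 * _ in step.
have q0 : 0 <= q by rewrite mulr_ge0 ?invr_ge0 ?sqr_ge0.
(* This [t] turns [t d + t^2 q] into [-(d/(q+1))^2]; the [+ 1] covers [h = 0], where [q = 0]. *)
have := step (- d / (q + 1)).
have q1 : 0 < q + 1 by lra.
have -> : - d / (q + 1) * d + (- d / (q + 1)) ^+ 2 * q
   = - (d / (q + 1)) ^+ 2 by field; rewrite gt_eqF.
rewrite oppr_ge0 => d2.
have : (d / (q + 1)) ^+ 2 == 0 by rewrite eq_le d2 sqr_ge0.
by rewrite sqrf_eq0 mulf_eq0 invr_eq0 (gt_eqF q1) orbF.
Unshelve. all: by end_near. Qed.

End InnerProduct.

Lemma bounded_linear_ex {R : realType} {X Z : hilbertType R}
    (T : {linear X -> Z}) : continuous T ->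
  exists2 C : R, 0 <= C & forall u, `|T u| <= C * `|u|.
Proof.
move=> /linear_bounded_continuous/linear_boundedP/pinfty_ex_gt0[C C0 TC].
by exists C => //; exact: ltW.
Qed.

(** Continuity bounds the set defining [opnorm], so its [sup] is a genuine least upper bound; then
    [u] is normalised. *)
Lemma opnorm_bound {R : realType} {X Z : hilbertType R}
    (T : {linear X -> Z}) (u : X) :
  continuous T -> `|T u| <= opnorm T * `|u|.
Proof.
move=> /bounded_linear_ex[C C0 TC].
have [->|u0] := eqVneq u 0; first by rewrite linear0 !normr0 mulr0.
have nu : 0 < `|u| by rewrite normr_gt0.
rewrite -ler_pdivrMr//; apply: ub_le_sup.
  exists C => _ [v /= v1 <-]; apply: le_trans (TC v) _.
  by rewrite -[leRHS]mulr1 ler_wpM2l.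
exists (`|u|^-1 *: u) => /=.
  by rewrite normrZ ger0_norm ?invr_ge0// mulVf// gt_eqF.
by rewrite linearZ normrZ ger0_norm ?invr_ge0// mulrC.
Qed.

(** * Subgradients at minimisers *)

Lemma ge0_of_quadratic {R : realType} (v c : R) :
  (forall t, 0 < t -> t < 1 -> 0 <= t * v + t ^+ 2 * c) -> 0 <= v.
Proof.
move=> h; rewrite leNgt; apply/negP => v0.
pose q := 2 * (`|c| - v + 1).
have q0 : 0 < q by rewrite /q; have := normr_ge0 c; lra.
have t0 : 0 < - v / q by rewrite divr_gt0// oppr_gt0.
have t1 : - v / q < 1.
  by rewrite ltr_pdivrMr// /q; have := normr_ge0 c; lra.
have := h _ t0 t1; rewrite expr2 -mulrA -mulrDr pmulr_rge0//.
suff : - v / q * c < - v by lra.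
apply: le_lt_trans (_ : - v / q * `|c| < _).
  by rewrite ler_wpM2l ?ler_norm// ltW.
rewrite mulrAC ltr_pdivrMr// /q; have := normr_ge0 c; nra.
Qed.

(** Comparing [x1] with [x1 + t *: (v - x1)], using convexity of [f] and the exact expansion of [Q],
    and letting [t] tend to 0 shows that minus the Riesz vector of [ell] is a subgradient of [f] at
    [x1]. The inequality in [S0] then applies to it. *)
Lemma argmin_quadratic_growth {R : realType} {X : hilbertType R}
    (f : X -> \bar R) (mu : R) (x1 : X) (Q ell c : X -> R) (C : R) :
  S0 mu f -> argmin setT (fun u => (f u + (Q u)%:E)%E) x1 ->
  (forall d t, Q (x1 + t *: d) = Q x1 + t * ell d + t ^+ 2 * c d) ->
  scalar ell -> (forall u, `|ell u| <= C * `|u|) ->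
  f x1 \is a fin_num /\ forall u, f u \is a fin_num ->
    mu / 2 * `|u - x1| ^+ 2 <= fine (f u) - fine (f x1) + ell (u - x1).
Proof.
move=> [[fNy _] _ _ fcvx fmu] [_ fx1 x1min] QE ellL ellC.
have fx1fin : f x1 \is a fin_num.
  rewrite fin_numE gt_eqF ?fNy//=.
  by apply: contraPN fx1 => /eqP ->; rewrite addye.
split => // u fufin.
have [w wE] := riesz_representation ellL ellC.
suff /(fmu u) : subdiff f x1 (- w).
  rewrite -(fineK fufin) -(fineK fx1fin) -!EFinB lee_fin.
  by rewrite innerNl wE opprK.
move=> v; have [->|vy] := eqVneq (f v) +oo%E; first by rewrite leey.
have fvfin : f v \is a fin_num by rewrite fin_numE gt_eqF ?fNy.
rewrite -(fineK fvfin) -(fineK fx1fin) -EFinD lee_fin innerNl wE.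
rewrite -subr_ge0 opprB addrA addrAC.
apply: (@ge0_of_quadratic _ _ (c (v - x1))) => t t0 t1.
have := x1min (x1 + t *: (v - x1)) I.
have := fcvx v x1 t t0 t1.
have -> : t *: v + (1 - t) *: x1 = x1 + t *: (v - x1).
  by rewrite scalerBl scalerBr scale1r addrCA addrC -!addrA.
rewrite QE -(fineK fvfin) -(fineK fx1fin) -!EFinM -!EFinD => h1 h2.
have := le_trans h2 (leeD2r _ h1).
rewrite -EFinD lee_fin; lra.
Qed.

(** * Well-posedness of the minimal norm problem *)

(** Lets lower semicontinuity be applied to each summand separately, including when a summand is
    [+oo]. *)
Lemma ereal_lt_split {R : realType} (c : R) (p q : \bar R) :
  (-oo < p)%E -> (-oo < q)%E -> (c%:E < p + q)%E ->
  exists a b : R, [/\ (a%:E < p)%E, (b%:E < q)%E & c < a + b].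
Proof.
case: p q => [r| |] [s| |] //= _ _.
- rewrite -EFinD lte_fin => crs.
  exists (r - (r + s - c) / 3), (s - (r + s - c) / 3).
  by rewrite !lte_fin; split; lra.
- by exists (r - 1), (c - r + 2); rewrite lte_fin ltry; split=> //; lra.
- by exists (c - s + 2), (s - 1); rewrite lte_fin ltry; split=> //; lra.
- by exists (c + 1), 0; rewrite !ltry; split=> //; lra.
Qed.

Lemma lower_semicontinuous_sum_le {R : realType} {X Y : hilbertType R}
    (f : X -> \bar R) (g : Y -> \bar R) (u : nat -> X) (v : nat -> Y) x y
    (c : R) (e : nat -> R) :
  lower_semicontinuous f -> lower_semicontinuous g ->
  (forall z, (-oo < f z)%E) -> (forall z, (-oo < g z)%E) ->
  u @ \oo --> x -> v @ \oo --> y -> e @ \oo --> 0 ->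
  (forall n, (f (u n) + g (v n) <= (c + e n)%:E)%E) -> (f x + g y <= c%:E)%E.
Proof.
move=> flsc glsc fNy gNy ux vy e0 fge; rewrite leNgt; apply/negP => cfg.
have [a [d [af dg cad]]] := ereal_lt_split (fNy x) (gNy y) cfg.
have [U xU Uf] := flsc _ _ af; have [V yV Vg] := glsc _ _ dg.
suff : a + d <= c + 0 by lra.
apply: (@cvgr_to_ge _ \oo _ R (fun n => c + e n)).
  by apply: cvgD => //; exact: cvg_cst.
near=> n; rewrite -lee_fin; apply: le_trans (fge n); rewrite EFinD.
apply: leeD; apply: ltW; [apply: Uf|apply: Vg]; near: n; [exact: ux|exact: vy].
Unshelve. all: by end_near. Qed.

Lemma solutions_fin {R : realType} {X Y Z : hilbertType R}
    (f : X -> \bar R) (g : Y -> \bar R) (A : X -> Z) (B : Y -> Z) (b : Z) p :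
  (forall x, (-oo < f x)%E) -> (forall y, (-oo < g y)%E) ->
  solutions f g A B b p -> f p.1 \is a fin_num /\ g p.2 \is a fin_num.
Proof.
move=> fNy gNy [_ fgy _]; move: fgy; rewrite /objective.
have := fNy p.1; have := gNy p.2.
by case: (f p.1) (g p.2) => [r| |] [s| |].
Qed.

Section MinimalNorm.
Context {R : realType} {X Y Z : hilbertType R}.
Variables (f : X -> \bar R) (g : Y -> \bar R).
Variables (A : {linear X -> Z}) (B : {linear Y -> Z}) (b : Z).
Hypotheses (cA : continuous A) (cB : continuous B).
Hypotheses (fNy : forall x, (-oo < f x)%E) (gNy : forall y, (-oo < g y)%E).
Hypotheses (flsc : lower_semicontinuous f) (glsc : lower_semicontinuous g).
Hypotheses (fcvx : convex_fun f) (gcvx : convex_fun g).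

Lemma midpoint_finite_convex {W : hilbertType R} (h : W -> \bar R) (u v : W) :
  convex_fun h -> (forall w, (-oo < h w)%E) ->
  h u \is a fin_num -> h v \is a fin_num ->
  exists2 m : R, h (2^-1 *: (u + v)) = m%:E &
    m <= 2^-1 * (fine (h u) + fine (h v)).
Proof.
move=> hcvx hNy hu hv; have := hcvx u v 2^-1.
have -> : 1 - 2^-1 = 2^-1 :> R by lra.
rewrite -scalerDr -(fineK hu) -(fineK hv) -!EFinM -EFinD.
have t0 : 0 < 2^-1 :> R by rewrite invr_gt0.
have t1 : 2^-1 < 1 :> R by lra.
move=> /(_ t0 t1); have := hNy (2^-1 *: (u + v)).
case: (h _) => [m| |] //= _; rewrite lee_fin => hm.
by exists m => //; rewrite mulrDr.
Qed.

Let sqn (p : X * Y) : R := `|p.1| ^+ 2 + `|p.2| ^+ 2.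

Lemma is_proj0_sqn (C : set (X * Y)) p q :
  is_proj C 0 p -> C q -> sqn p <= sqn q.
Proof.
case=> _ /[apply]; by rewrite /pnorm !subr0 ler_sqrt// addr_ge0 ?sqr_ge0.
Qed.

Variable phi : R.

Let near_sol (t : R) : set (X * Y) :=
  [set p | [/\ f p.1 \is a fin_num, g p.2 \is a fin_num,
    fine (f p.1) + fine (g p.2) <= phi + t & `|A p.1 + B p.2 - b| <= t]].

Let mid (p q : X * Y) : X * Y := (2^-1 *: (p.1 + q.1), 2^-1 *: (p.2 + q.2)).

Let near_sol_mid t p q : near_sol t p -> near_sol t q -> near_sol t (mid p q).
Proof.
move=> [fp gp vp rp] [fq gq vq rq]; rewrite /near_sol/=.
have [m -> mle] := midpoint_finite_convex fcvx fNy fp fq.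
have [n -> nle] := midpoint_finite_convex gcvx gNy gp gq.
split=> //=; first by lra.
rewrite !linearZ !linearD/=.
have -> : 2^-1 *: (A p.1 + A q.1) + 2^-1 *: (B p.2 + B q.2) - b =
  2^-1 *: ((A p.1 + B p.2 - b) + (A q.1 + B q.2 - b)).
  rewrite [X in _ - X](_ : b = 2^-1 *: (b + b)).
    rewrite -scalerDr -scalerBr; congr (_ *: _).
    by rewrite [RHS]addrACA -opprD [in RHS]addrACA.
  by rewrite -mulr2n -(scaler_nat 2 b) scalerA mulVf// scale1r.
rewrite normrZ ger0_norm ?invr_ge0//.
have := ler_normD (A p.1 + B p.2 - b) (A q.1 + B q.2 - b); lra.
Qed.

Let sqn_mid p q : `|p.1 - q.1| ^+ 2 + `|p.2 - q.2| ^+ 2 =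
  2 * sqn p + 2 * sqn q - 4 * sqn (mid p q).
Proof. by rewrite !parallelogram /sqn /mid/=; ring. Qed.

(* Tikhonov well-posedness: the infimum of the norm over the [t]-approximate
   solutions increases to the minimal norm as [t] decreases to [0], and the
   parallelogram law turns closeness of norms into closeness of points. *)
Lemma min_norm_well_posed (pbar : X * Y) :
  is_proj (solutions f g A B b) 0 pbar ->
  fine (f pbar.1) + fine (g pbar.2) = phi ->
  forall e, 0 < e -> exists2 t, 0 < t & forall x y,
    f x \is a fin_num -> g y \is a fin_num ->
    fine (f x) + fine (g y) <= phi + t -> `|A x + B y - b| <= t ->
    `|x| ^+ 2 + `|y| ^+ 2 <= `|pbar.1| ^+ 2 + `|pbar.2| ^+ 2 + t ->
    `|x - pbar.1| ^+ 2 + `|y - pbar.2| ^+ 2 <= e.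
Proof.
move=> pproj phiE e e0.
have [psol _] := pproj; have [fp gp] := solutions_fin fNy gNy psol.
have [pfeas _ pmin] := psol.
pose m t := inf (sqn @` near_sol t).
have sol_near t : 0 <= t -> near_sol t pbar.
  by move=> t0; split=> //; rewrite ?phiE ?lerDl// pfeas subrr normr0.
have lbm t : lbound (sqn @` near_sol t) 0.
  by move=> _ [p _ <-]; rewrite addr_ge0 ?sqr_ge0.
have m_le t p : near_sol t p -> m t <= sqn p.
  by move=> tp; apply: ge_inf; [exists 0; exact: lbm|exists p].
pose h (n : nat) : R := n.+1%:R^-1.
have h0 n : 0 < h n by rewrite invr_gt0.
have hcvg : h @ \oo --> 0 by exact: cvg_harmonic.
have hmono n k : (n <= k)%N -> h k <= h n.
  by move=> nk; rewrite lef_pV2 ?posrE// ler_nat ltnS.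
have near_mono s t p : s <= t -> near_sol s p -> near_sol t p.
  move=> st [? ? v r]; split=> //; last exact: le_trans st.
  by apply: le_trans v _; rewrite lerD2l.
pose a n := m (h n).
have amono : {homo a : n k / (n <= k)%N >-> n <= k}.
  move=> n k nk; apply: lb_le_inf.
    by exists (sqn pbar); exists pbar => //; apply: sol_near; exact: ltW.
  by move=> _ [p kp <-]; apply: m_le; apply: near_mono kp; exact: hmono.
have a_le n : a n <= sqn pbar by apply/m_le/sol_near/ltW.
have acvg : cvgn a.
  by apply: nondecreasing_is_cvgn => //; exists (sqn pbar) => _ [n _ <-].
have a_lim n : a n <= limn a by exact: nondecreasing_cvgn_le.
have /choice[p pP] : forall n, exists p, near_sol (h n) p /\ sqn p <= a n + h n.
  move=> n; have [||_ [p np <-] /ltW pa] :=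
    @inf_adherent _ (sqn @` near_sol (h n)) (h n).
  - exact: h0.
  - split; last by exists 0; exact: lbm.
    by exists (sqn pbar); exists pbar => //; apply: sol_near; exact: ltW.
  - by exists p.
(* The midpoint is again [h n]-approximate, so its squared norm is at least [a n], while those of
   [p k] and [p n] are at most [limn a + h n] and [a n + h n]. *)
have pC n k : (n <= k)%N ->
    `|(p k).1 - (p n).1| ^+ 2 + `|(p k).2 - (p n).2| ^+ 2
    <= 2 * (limn a - a n) + 4 * h n.
  move=> nk; rewrite sqn_mid.
  have : a n <= sqn (mid (p k) (p n)).
    apply: m_le; apply: near_sol_mid (pP n).1.
    by apply: near_mono (pP k).1; exact: hmono.
  have := (pP n).2; have := (pP k).2; have := a_lim k; have := hmono _ _ nk.
  move: (sqn _) (sqn _) (sqn _) => ? ? ?.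
  move: (h n) (h k) (a n) (a k) => ? ? ? ?; lra.
have ecvg : (fun n => 2 * (limn a - a n) + 4 * h n) @ \oo --> 0.
  have -> : 0 = 2 * (limn a - limn a) + 4 * 0 :> R by ring.
  apply: cvgD; apply: cvgMr => //; apply: cvgB => //; exact: cvg_cst.
have c1 : cvgn (fun n => (p n).1).
  apply: (cvgn_sqr_cauchy ecvg) => n k /pC; apply: le_trans.
  by rewrite lerDl sqr_ge0.
have c2 : cvgn (fun n => (p n).2).
  apply: (cvgn_sqr_cauchy ecvg) => n k /pC; apply: le_trans.
  by rewrite lerDr sqr_ge0.
set u := limn (fun n => (p n).1) in c1; set v := limn (fun n => (p n).2) in c2.
have uv_val : (f u + g v <= phi%:E)%E.
  apply: (@lower_semicontinuous_sum_le _ _ _ _ _ _ _ _ _ _ h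
    flsc glsc fNy gNy c1 c2 hcvg).
  move=> n; have [[fn gn vn _] _] := pP n.
  by rewrite -(fineK fn) -(fineK gn) -EFinD lee_fin.
have uv_feas : A u + B v = b.
  apply/eqP; rewrite -subr_eq0 -normr_le0.
  have rc : (fun n => h n - `|A (p n).1 + B (p n).2 - b|) @ \oo -->
      0 - `|A u + B v - b|.
    apply: cvgB => //; apply: cvg_norm; apply: cvgB; last exact: cvg_cst.
    apply: cvgD; [apply: continuous_cvg c1; exact: cA|].
    by apply: continuous_cvg c2; exact: cB.
  have : 0 <= 0 - `|A u + B v - b|.
    apply: (cvgr_to_ge rc); near=> n; rewrite subr_ge0.
    by have [[]] := pP n.
  by rewrite sub0r oppr_ge0.
have uv_sol : solutions f g A B b (u, v).
  have objE : objective f g pbar = phi%:E.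
    by rewrite /objective -(fineK fp) -(fineK gp) -EFinD phiE.
  split=> //; first by apply: le_lt_trans uv_val _; rewrite ltry.
  by move=> q /pmin; apply: le_trans; rewrite objE.
(* The limit [(u, v)] of the near-minimal points is a solution, so it cannot be shorter than [pbar];
   hence [a] increases to [sqn pbar]. *)
have lim_ge : sqn pbar <= limn a.
  apply: le_trans (is_proj0_sqn pproj uv_sol) _.
  have sc : (fun n => a n + h n - sqn (p n)) @ \oo --> limn a + 0 - sqn (u, v).
    apply: cvgB; first exact: cvgD.
    apply: cvgD; first exact: cvgM (cvg_norm c1) (cvg_norm c1).
    exact: cvgM (cvg_norm c2) (cvg_norm c2).
  have : 0 <= limn a + 0 - sqn (u, v).
    apply: (cvgr_to_ge sc); near=> n; rewrite subr_ge0.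
    by have [] := pP n.
  by rewrite addr0 subr_ge0.
have [n an] : exists n, sqn pbar - e / 8 <= a n.
  have /cvgrPdist_le/(_ (e / 8)) := acvg.
  rewrite divr_gt0// => /(_ isT)[n _ /(_ n (leqnn n))] /=.
  move=> /ler_normlP[_ h8]; exists n; lra.
(* In the parallelogram law with [pbar], the norm excess contributes at most [2 * e/8] and the
   midpoint at most [4 * e/8], in total below [e]. *)
exists (Num.min (h n) (e / 8)); first by rewrite lt_min h0 divr_gt0.
move=> x y fx gy vxy rxy nxy.
have xy_near : near_sol (h n) (x, y).
  apply: (near_mono (Num.min (h n) (e / 8))); last by split.
  by rewrite ge_min lexx.
have := m_le _ _ (near_sol_mid xy_near (sol_near _ (ltW (h0 n)))).
have := @sqn_mid (x, y) pbar => /= ->.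
have : Num.min (h n) (e / 8) <= e / 8 by rewrite ge_min lexx orbT.
move: nxy an; rewrite /a /sqn /=.
move: (Num.min _ _) (m (h n)) => mi mm.
move: (`|2^-1 *: (x + pbar.1)| ^+ 2 + _) (`|x| ^+ 2 + _) (`|pbar.1| ^+ 2 + _).
move=> sm sx sp; lra.
Unshelve. all: by end_near. Qed.

End MinimalNorm.

(** * Scalar recursions and multipliers *)

(** Summing from a late index [m] and using monotonicity of [beta] gives
    [G n <= G m + C beta_n (S n - S m)]. The tail of [S] is small, and the constant [G m] is
    absorbed since [beta] is unbounded. *)
Lemma kronecker_little_o {R : realType} (m0 : nat) (G beta S : nat -> R)
    (C : R) :
  0 <= C -> beta @ \oo --> +oo -> cvgn S ->
  (forall k, (m0 <= k)%N -> 0 < beta k) ->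
  (forall k, (m0 <= k)%N -> beta k <= beta k.+1) ->
  (forall k, (m0 <= k)%N -> S k <= S k.+1) ->
  (forall k, (m0 <= k)%N -> G k.+1 <= G k + C * (beta k * (S k.+1 - S k))) ->
  forall e, 0 < e -> \forall n \near \oo, G n <= e * beta n.
Proof.
move=> C0 bcvg Scvg b0 bmono Smono Gstep e e0.
have C1 : 0 < C + 1 by lra.
(* Two such distances to the limit of [S] cost at most [e/2] after multiplication by [C]; the other
   half is left for [G m]. The [+ 1] covers [C = 0]. *)
have t0 : 0 < e / (4 * (C + 1)) by rewrite divr_gt0// mulr_gt0.
have /cvgrPdist_le/(_ _ t0)[N _ SN] := Scvg.
pose m := maxn m0 N.
have Smle n : (m <= n)%N -> S n - S m <= e / (2 * (C + 1)).
  move=> mn; have /ler_normlP[h1 h2] := SN m (leq_maxr _ _).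
  have /ler_normlP[h3 h4] := SN n (leq_trans (leq_maxr _ _) mn).
  have -> : e / (2 * (C + 1)) = 2 * (e / (4 * (C + 1))).
    by field; rewrite gt_eqF.
  move: h1 h2 h3 h4; move: (e / _) (S n) (S m) => a c d; lra.
have mle n : (m <= n)%N -> (m0 <= n)%N by apply: leq_trans; exact: leq_maxl.
have Smono' n : (m <= n)%N -> S m <= S n.
  elim: n => [|n IH]; first by rewrite leqn0 => /eqP ->.
  rewrite leq_eqVlt => /predU1P[<-//|]; rewrite ltnS => mn.
  exact: le_trans (IH mn) (Smono _ (mle _ mn)).
have Gle n : (m <= n)%N -> G n <= G m + C * (beta n * (S n - S m)).
  elim: n => [|n IH].
    by rewrite leqn0 => /eqP ->; rewrite subrr !mulr0 addr0.
  rewrite leq_eqVlt => /predU1P[<-|]; first by rewrite subrr !mulr0 addr0.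
  rewrite ltnS => mn; apply: le_trans (Gstep _ (mle _ mn)) _.
  apply: le_trans (lerD (IH mn) (lexx _)) _.
  rewrite -addrA lerD2l -mulrDr ler_wpM2l// -mulrDr addrC addrA subrK.
  rewrite ler_wpM2r ?bmono ?mle// subr_ge0 (le_trans (Smono' _ mn))//.
  exact: Smono (mle _ mn).
have /cvgryPge/(_ (2 * G m / e)) := bcvg.
apply: filterS2; last exact: nbhs_infty_ge m.
move=> n mn; rewrite ler_pdivrMr// => bG.
apply: le_trans (Gle _ mn) _.
have bn := b0 _ (mle _ mn).
have : C * (beta n * (S n - S m)) <= e / 2 * beta n.
  rewrite mulrCA [leRHS]mulrC ler_pM2l//.
  apply: le_trans (ler_wpM2l C0 (Smle _ mn)) _.
  have -> : C * (e / (2 * (C + 1))) = e / 2 * (C / (C + 1)).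
    by field; rewrite gt_eqF.
  apply: ler_piMr; first by rewrite divr_ge0// ltW.
  by rewrite ler_pdivrMr// mul1r lerDl.
move: (C * _) => a; lra.
Qed.

Lemma summable_partial_sums {R : realType} (s : nat -> R) :
  (forall k, (1 <= k)%N -> 0 <= s k) ->
  (\sum_(1 <= k <oo) (s k)%:E < +oo)%E ->
  cvgn (fun n => \sum_(1 <= k < n) s k).
Proof.
move=> s0 slt; pose T := (\sum_(1 <= k <oo) (s k)%:E)%E.
have partial n : ((\sum_(1 <= k < n) s k)%:E <= T)%E.
  by rewrite -sumEFin; apply: nneseries_lim_ge => k k1 _; rewrite lee_fin s0.
have Tfin : T \is a fin_num.
  rewrite ge0_fin_numE//; have := partial 0%N.
  by rewrite big_geq.
apply: nondecreasing_is_cvgn.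
  apply/nondecreasing_seqP => -[|n]; first by rewrite !big_geq.
  by rewrite [leRHS]big_nat_recr//= lerDl s0.
exists (fine T) => _ [n _ <-]; rewrite -lee_fin fineK//.
Qed.

(** Put [c k = lam k - de be_k r_k]. The recursion gives [c (k+1) = (1 - t) lam (k+1) + t c k] with
    [t = de be_(k+1) / ((al_k + de) be_k)], and the step condition says [t <= 1]. So [c - ls]
    inherits the [o(be)] bound of [lam - ls], and [r] is their difference divided by [de be]. *)
Lemma averaged_multiplier_little_o {R : realType} {Z : hilbertType R}
    (de : R) (al be : nat -> R) (lam r : nat -> Z) (ls : Z) :
  0 < de -> (forall k, (1 <= k)%N -> 0 < be k) ->
  (forall k, (1 <= k)%N -> 0 < al k) ->
  (forall k, (1 <= k)%N -> be k <= be k.+1) -> be @ \oo --> +oo ->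
  (forall k, (1 <= k)%N -> de * be k.+1 <= (al k + de) * be k) ->
  (forall k, (1 <= k)%N -> ((al k + de) * be k) *: r k.+1 =
     (de * be k) *: r k + (lam k.+1 - lam k)) ->
  (forall e, 0 < e -> \forall n \near \oo, `|lam n - ls| <= e * be n) ->
  forall e, 0 < e -> \forall n \near \oo, `|r n| <= e.
Proof.
move=> de0 be0 al0 bmono bcvg step rE lamo e e0.
pose d := de * e / 4.
have d0 : 0 < d by rewrite divr_gt0// mulr_gt0.
have [N _ lamN] := lamo _ d0.
pose m := maxn 1 N.
have m1 n : (m <= n)%N -> (1 <= n)%N by apply: leq_trans; exact: leq_maxl.
have lamm n : (m <= n)%N -> `|lam n - ls| <= d * be n.
  by move=> mn; apply: lamN; apply: leq_trans mn; exact: leq_maxr.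
pose c k := lam k - (de * be k) *: r k.
have cE k : (1 <= k)%N -> exists t, [/\ 0 <= t, t <= 1 &
    c k.+1 - ls = (1 - t) *: (lam k.+1 - ls) + t *: (c k - ls)].
  move=> k1; have th0 : 0 < (al k + de) * be k.
    by apply: mulr_gt0; [apply: addr_gt0 => //; exact: al0|exact: be0].
  exists (de * be k.+1 / ((al k + de) * be k)); split.
  - apply: divr_ge0; last exact: ltW.
    by apply: mulr_ge0; apply: ltW => //; apply: be0.
  - by rewrite ler_pdivrMr// mul1r step.
  set t := _ / _.
  have -> : c k.+1 = lam k.+1 - t *: ((de * be k) *: r k + (lam k.+1 - lam k)).
    by rewrite /c -rE// scalerA divfK ?gt_eqF.
  by apply: inner_ext => v; rewrite /c !innerE; ring.
have cle n : (m <= n)%N -> `|c n - ls| <= `|c m - ls| + d * be n.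
  elim: n => [|n IH].
    by rewrite leqn0 => /eqP m0; move: (m1 m (leqnn m)); rewrite m0.
  rewrite leq_eqVlt => /predU1P[<-|].
    rewrite lerDl; apply: mulr_ge0; first exact: ltW.
    by apply/ltW/be0/m1.
  rewrite ltnS => mn; have n1 := m1 _ mn.
  have [t [t0 t1 ->]] := cE n n1.
  have t1' : 0 <= 1 - t by rewrite subr_ge0.
  apply: le_trans (ler_normD _ _) _; rewrite !normrZ !ger0_norm//.
  have h1 := ler_wpM2l t1' (lamm n.+1 (leqW mn)).
  have h2 := ler_wpM2l t0 (IH mn).
  have h3 : t * (d * be n) <= t * (d * be n.+1).
    by rewrite ler_wpM2l// ler_wpM2l ?bmono// ltW.
  have h4 : 0 <= (1 - t) * `|c m - ls| by rewrite mulr_ge0.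
  lra.
have /cvgryPge/(_ (`|c m - ls| / d)) := bcvg.
apply: filterS2; last exact: nbhs_infty_ge m.
move=> n mn; rewrite ler_pdivrMr// => bc.
have bn := be0 _ (m1 _ mn).
have debn : 0 < de * be n by rewrite mulr_gt0.
rewrite -(ler_pM2l debn) -[X in X * `|r n|]gtr0_norm// -normrZ.
have -> : (de * be n) *: r n = (lam n - ls) - (c n - ls).
  by apply: inner_ext => v; rewrite /c !innerE; ring.
apply: le_trans (ler_normB _ _) _.
have := cle _ mn; have := lamm _ mn; rewrite /d in bc *; nra.
Qed.

(** The saddle value is finite by comparison with the solution [p], and the multiplier [lams] plus
    the residual forces [(xs, ys)] to be feasible. The saddle value is thus at least the optimal
    value, and it minimizes the Lagrangian at [lams]. *)
Lemma saddle_lower_bound {R : realType} {X Y Z : hilbertType R}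
    (f : X -> \bar R) (g : Y -> \bar R) (A : X -> Z) (B : Y -> Z)
    (b : Z) (xs : X) (ys : Y) (lams : Z) (p : X * Y) x y :
  (forall x, (-oo < f x)%E) -> (forall y, (-oo < g y)%E) ->
  saddle f g A B b xs ys lams -> solutions f g A B b p ->
  f x \is a fin_num -> g y \is a fin_num ->
  fine (f p.1) + fine (g p.2)
  <= fine (f x) + fine (g y) + '<lams, A x + B y - b>.
Proof.
move=> fNy gNy sad psol fx gy.
have [fp gp] := solutions_fin fNy gNy psol.
have [pfeas _ pmin] := psol.
have sadp := (sad p.1 p.2 0).2.
rewrite {2}/lagr pfeas subrr innerC inner0l adde0 in sadp.
have [fxs gys] : f xs \is a fin_num /\ g ys \is a fin_num.
  move: sadp; rewrite /lagr -(fineK fp) -(fineK gp) -EFinD.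
  have := fNy xs; have := gNy ys.
  by case: (f xs) (g ys) => [?| |] [?| |].
have sfeas : A xs + B ys = b.
  apply/eqP; rewrite -subr_eq0 -normr_eq0 -sqrf_eq0 eq_le sqr_ge0 andbT.
  have := (sad xs ys (lams + (A xs + B ys - b))).1.
  rewrite /lagr -(fineK fxs) -(fineK gys) -!EFinD lee_fin lerD2l.
  by rewrite innerDl -inner_norm gerDl.
have := pmin (xs, ys) sfeas; rewrite /objective/= => h1.
have h2 := (sad x y 0).2; move: h2.
rewrite {1}/lagr sfeas subrr innerC inner0l adde0 => h2.
have := le_trans h1 h2; rewrite /lagr.
by rewrite -(fineK fp) -(fineK gp) -(fineK fx) -(fineK gy) -!EFinD lee_fin.
Qed.

(** * Energy descent *)

(** Since [u1 = x1 + (de/al)(x1 - x0)], the growth inequality at [s] with weight [al be] and the one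
    at [x0] with weight [de be] combine into a test at [u1 - s]. What remains is minus a sum of
    squares with nonnegative coefficients. *)
Lemma primal_block_descent {R : realType} {X : hilbertType R}
    (al be de ga mu ep : R) (x0 x1 s z0 z1 : X) (M : X -> R) (F0 F1 Fs : R) :
  0 < al -> 0 < be -> 0 < de -> 0 <= de * ga - 1 -> 0 <= mu -> 0 <= ep ->
  scalar M ->
  let ell d := (al * be)^-1 * '<z1 - z0 + (mu * de * be) *: (x1 - x0), d>
               + ep * '<x1, d> + M d in
  let u0 := de *: z0 + (1 - de * ga) *: x0 in
  let u1 := de *: z1 + (1 - de * ga) *: x1 in
  z1 = al^-1 *: (x1 - x0) + ga *: x1 ->
  mu / 2 * `|s - x1| ^+ 2 <= Fs - F1 + ell (s - x1) ->
  mu / 2 * `|x0 - x1| ^+ 2 <= F0 - F1 + ell (x0 - x1) ->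
  (al + de) * be * (F1 + ep / 2 * `|x1| ^+ 2)
  - de * be * (F0 + ep / 2 * `|x0| ^+ 2)
  - al * be * (Fs + ep / 2 * `|s| ^+ 2)
  + al * be * M (u1 - s)
  + (2 * de)^-1 * (`|u1 - s| ^+ 2 - `|u0 - s| ^+ 2)
  + (de * ga - 1) / (2 * de) * (`|x1 - s| ^+ 2 - `|x0 - s| ^+ 2)
  + al * be * mu / 2 * `|u1 - s| ^+ 2 <= 0.
Proof.
move=> al0 be0 de0 dg mu0 ep0 ML ell u0 u1 z1E h1 h0.
pose g1 := al * be * (Fs - F1 + ell (s - x1) - mu / 2 * `|s - x1| ^+ 2).
pose g0 := de * be * (F0 - F1 + ell (x0 - x1) - mu / 2 * `|x0 - x1| ^+ 2).
pose c := (de * ga - 1) / de * (2^-1 + de / al)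
  + (de * be * ep / 2 + de * be * mu / 2 + mu * de ^+ 2 * be / (2 * al)).
have g1_ge0 : 0 <= g1 by rewrite mulr_ge0 ?subr_ge0// mulr_ge0// ltW.
have g0_ge0 : 0 <= g0 by rewrite mulr_ge0 ?subr_ge0// mulr_ge0// ltW.
have r1_ge0 : 0 <= (2 * de)^-1 * `|u1 - u0| ^+ 2.
  by rewrite mulr_ge0 ?sqr_ge0// invr_ge0 mulr_ge0// ltW.
have r2_ge0 : 0 <= c * `|x1 - x0| ^+ 2.
  rewrite mulr_ge0 ?sqr_ge0// /c addr_ge0//.
    apply: mulr_ge0; first by rewrite divr_ge0// ltW.
    by rewrite addr_ge0// divr_ge0// ltW.
  by rewrite !addr_ge0// !(mulr_ge0, invr_ge0, exprn_ge0)// ltW.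
have r3_ge0 : 0 <= al * be * ep / 2 * `|x1 - s| ^+ 2.
  by rewrite !mulr_ge0 ?sqr_ge0// ltW.
set L := (X in X <= 0).
suff -> : L = - (g1 + g0 + (2 * de)^-1 * `|u1 - u0| ^+ 2 + c * `|x1 - x0| ^+ 2
                 + al * be * ep / 2 * `|x1 - s| ^+ 2).
  by rewrite oppr_le0 !addr_ge0.
rewrite /L /g1 /g0 /c /ell /u1 /u0 z1E -!inner_norm !innerE.
rewrite !(scalarD ML, scalarN ML, scalarZ ML).
rewrite (innerC x1 x0) (innerC s x0) (innerC s x1).
rewrite (innerC z0 x0) (innerC z0 x1) (innerC z0 s).
field.
by rewrite !gt_eqF.
Qed.

Lemma linopE {R : realType} {X Z : hilbertType R} (T : {linear X -> Z}) :
  ((forall u v, T (u + v) = T u + T v) * (forall u, T (- u) = - T u)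
   * (forall a u, T (a *: u) = a *: T u)).
Proof.
split; last by move=> a u; rewrite linearZ.
by split; [exact: linearD|exact: linearN].
Qed.

(** Common form of both subproblems: [k0] is the value of the other function and [a] the other
    block's share of the residual. The linear functional is the derivative at [x1] of the quadratic
    part. *)
Lemma subproblem_growth {R : realType} {X Z : hilbertType R} (f : X -> \bar R)
    (mu : R) (T : {linear X -> Z}) (a lam : Z) (k0 th rho ep : R) (xt x1 : X) :
  continuous T -> S0 mu f ->
  argmin setT (fun u => (f u + (k0 + '<lam, T u + a> + th / 2 * `|T u + a| ^+ 2
    + rho * `|u - xt| ^+ 2 + ep / 2 * `|u| ^+ 2)%:E)%E) x1 ->
  f x1 \is a fin_num /\ forall u, f u \is a fin_num ->
    mu / 2 * `|u - x1| ^+ 2 <= fine (f u) - fine (f x1)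
      + ('<lam + th *: (T x1 + a), T (u - x1)>
         + 2 * rho * '<x1 - xt, u - x1> + ep * '<x1, u - x1>).
Proof.
move=> cT fS x1min; have [CT CT0 TC] := bounded_linear_ex cT.
pose w := lam + th *: (T x1 + a).
pose ell d := '<w, T d> + 2 * rho * '<x1 - xt, d> + ep * '<x1, d>.
apply: (@argmin_quadratic_growth _ _ f mu x1 _ ell
  (fun d => th / 2 * `|T d| ^+ 2 + (rho + ep / 2) * `|d| ^+ 2)
  (`|w| * CT + `|2 * rho| * `|x1 - xt| + `|ep| * `|x1|) fS x1min).
- move=> d t; rewrite /ell /w !(linearD, linearZ)/= -!inner_norm !innerE.
  rewrite (innerC (T d) (T x1)) (innerC (T d) a) (innerC a (T x1)).
  by rewrite (innerC d x1) (innerC d xt) (innerC xt x1); field.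
- by move=> t u v; rewrite /ell [T _]linearP !innerE; ring.
- move=> u; rewrite [leRHS]mulrDl [X in _ <= X + _]mulrDl.
  apply: le_trans (ler_normD _ _) _; apply: lerD.
    apply: le_trans (ler_normD _ _) _; apply: lerD.
      apply: le_trans (norm_inner_le _ _) _.
      by rewrite -mulrA ler_wpM2l.
    by rewrite normrM -mulrA ler_wpM2l// norm_inner_le.
  by rewrite normrM -mulrA ler_wpM2l// norm_inner_le.
Qed.

Lemma prox_term {R : realType} {X : hilbertType R} (al be ga de mu et : R)
    (x0 x1 z0 z1 d : X) :
  0 < al -> 0 < be -> 0 < et -> et = ga + al^-1 + mu * de * be ->
  z1 = al^-1 *: (x1 - x0) + ga *: x1 ->
  2 * (et / (2 * al * be)) * '<x1 - (x0 + et^-1 *: (z0 - ga *: x0)), d>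
  = (al * be)^-1 * '<z1 - z0 + (mu * de * be) *: (x1 - x0), d>.
Proof.
move=> al0 be0 et0 etE ->; rewrite !innerE.
transitivity ((al * be)^-1 *
    (et * ('<x1, d> - '<x0, d>) - ('<z0, d> - ga * '<x0, d>))).
  by field; rewrite !gt_eqF.
by rewrite etE; field; rewrite !gt_eqF.
Qed.

(** The two sides differ by exactly half the square of [|(l1 - l0) - (v1 - v0)|]. *)
Lemma dual_block_descent {R : realType} {Z : hilbertType R}
    (l0 l1 ls v0 v1 : Z) :
  2^-1 * (`|l1 - ls| ^+ 2 - `|l0 - ls| ^+ 2) + 2^-1 * (`|v1| ^+ 2 - `|v0| ^+ 2)
  <= '<l1 - (v1 - v0), (l1 - l0) - v1> + '<l1, v1> - '<ls, l1 - l0>.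
Proof.
have := sqr_ge0 `|(l1 - l0) - (v1 - v0)|; rewrite -!inner_norm !innerE.
rewrite (innerC l1 l0) (innerC ls l0) (innerC ls l1) (innerC v1 v0).
rewrite (innerC v0 l0) (innerC v0 l1) (innerC v1 l0) (innerC v1 l1).
lra.
Qed.

Section Iterates.
Context {R : realType} {X Y Z : hilbertType R}.
Variables (f : X -> \bar R) (g : Y -> \bar R).
Variables (A : {linear X -> Z}) (B : {linear Y -> Z}) (b : Z).
Hypotheses (hA : continuous A) (hB : continuous B).
Variables (mu_f mu_g delta gamma : R) (alpha beta eps : nat -> R).
Variables (x Zs : nat -> X) (y Hs : nat -> Y) (lam : nat -> Z).
Hypotheses (hmu_f : 0 <= mu_f) (hmu_g : 0 <= mu_g).
Hypotheses (hf : S0 mu_f f) (hg : S0 mu_g g).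
Hypothesis beta_gt0 : forall k, (1 <= k)%N -> 0 < beta k.
Hypothesis alpha_gt0 : forall k, (1 <= k)%N -> 0 < alpha k.
Hypotheses (delta_gt0 : 0 < delta) (gamma_gt0 : 0 < gamma).
Hypothesis (hdg : 0 <= delta * gamma - 1).
Hypothesis halg : pds_algorithm f g A B b mu_f mu_g delta gamma alpha beta eps
              x Zs y Hs lam.
Hypothesis eps_ge0 : forall k, (1 <= k)%N -> 0 <= eps k.

Let r k := A (x k) + B (y k) - b.
Let U k := Zdelta delta gamma x Zs k.
Let W k := Hdelta delta gamma y Hs k.

(** Extrapolation [Zdelta (k+1) = x (k+1) + (delta/alpha_k)(x (k+1) - x k)], and likewise for
    [Hdelta], turns the multiplier update into a weighted difference of residuals. *)
Lemma multiplier_step k : (1 <= k)%N ->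
  ((alpha k + delta) * beta k) *: r k.+1
    = (delta * beta k) *: r k + (lam k.+1 - lam k).
Proof.
move=> k1; have a0 := alpha_gt0 k1.
apply: inner_ext => v; rewrite (pds_lam halg k1) /r /Zdelta /Hdelta.
rewrite (pds_Z halg k1) (pds_H halg k1) !(linopE A, linopE B) !innerE.
by field; rewrite gt_eqF.
Qed.

Lemma eta_gt0 mu k :
  0 <= mu -> (1 <= k)%N -> 0 < eta delta gamma alpha beta mu k.
Proof.
move=> mu0 k1; rewrite /eta ltr_wpDr ?addr_gt0 ?invr_gt0 ?alpha_gt0//.
by apply: mulr_ge0; [exact: mulr_ge0 (ltW _)|exact/ltW/beta_gt0].
Qed.

Lemma y_growth k : (1 <= k)%N ->
  g (y k.+1) \is a fin_num /\ forall v, g v \is a fin_num ->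
    mu_g / 2 * `|v - y k.+1| ^+ 2 <= fine (g v) - fine (g (y k.+1)) +
      ((alpha k * beta k)^-1 * '<Hs k.+1 - Hs k
          + (mu_g * delta * beta k) *: (y k.+1 - y k), v - y k.+1>
       + eps k * '<y k.+1, v - y k.+1> + '<lam k.+1, B (v - y k.+1)>).
Proof.
move=> k1; have a0 := alpha_gt0 k1; have b0 := beta_gt0 k1.
have e0 := eta_gt0 hmu_g k1.
have [_ ylt ymin] := pds_y halg k1.
(* Here [f (x k.+1)] is an additive constant; the definition of [argmin] makes the minimal value
   finite, so the constant is finite too. *)
have fx : f (x k.+1) \is a fin_num.
  have [[fNy _] _ _ _ _] := hf; have [[gNy _] _ _ _ _] := hg.
  move: ylt; rewrite /y_subproblem /aug_lagr /lagr.
  have := fNy (x k.+1); have := gNy (y k.+1).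
  by case: (f _) (g _) => [?| |] [?| |].
have subE v :
    y_subproblem f g A B b mu_g delta gamma alpha beta eps x y Hs lam k v
    = (g v + (fine (f (x k.+1))
      + '<lam2 A B b delta beta x y lam k, B v + (A (x k.+1) - b)>
      + theta delta alpha beta k / 2 * `|B v + (A (x k.+1) - b)| ^+ 2
      + eta delta gamma alpha beta mu_g k / (2 * alpha k * beta k)
        * `|v - ytilde mu_g delta gamma alpha beta y Hs k| ^+ 2
      + eps k / 2 * `|v| ^+ 2)%:E)%E.
  rewrite /y_subproblem /aug_lagr /lagr -(fineK fx) addrA (addrC (B v)).
  by rewrite (addeC _ (g v)) -!addeA -!EFinD !addrA.
have [] := @subproblem_growth _ _ _ g mu_g B (A (x k.+1) - b)
   (lam2 A B b delta beta x y lam k) (fine (f (x k.+1)))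
   (theta delta alpha beta k)
   (eta delta gamma alpha beta mu_g k / (2 * alpha k * beta k)) (eps k)
   (ytilde mu_g delta gamma alpha beta y Hs k) (y k.+1) hB hg.
  split=> //; first by rewrite -subE.
  by move=> v _; rewrite -!subE; exact: ymin.
move=> gy growth; split=> // v gv.
apply: le_trans (growth v gv) _; rewrite lerD2l.
rewrite (prox_term _ _ a0 b0 e0 erefl (pds_H halg k1)).
have -> : lam2 A B b delta beta x y lam k
    + theta delta alpha beta k *: (B (y k.+1) + (A (x k.+1) - b)) = lam k.+1.
  apply: inner_ext => w; rewrite (pds_lam halg k1).
  rewrite /lam2 /theta /resid /Zdelta /Hdelta.
  rewrite (pds_Z halg k1) (pds_H halg k1) !(linopE A, linopE B) !innerE.
  by field; rewrite gt_eqF.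
by rewrite le_eqVlt; apply/orP; left; apply/eqP; ring.
Qed.

(** The x-step still sees [y k]. The correction in [lam1] makes the resulting error exactly
    [alpha_k beta_k B(W k.+1 - W k)], an increment that [dual_block_descent] can absorb. *)
Lemma x_growth k : (1 <= k)%N ->
  [/\ f (x k.+1) \is a fin_num, g (y k) \is a fin_num &
    forall u, f u \is a fin_num ->
    mu_f / 2 * `|u - x k.+1| ^+ 2 <= fine (f u) - fine (f (x k.+1)) +
      ((alpha k * beta k)^-1 * '<Zs k.+1 - Zs k
          + (mu_f * delta * beta k) *: (x k.+1 - x k), u - x k.+1>
       + eps k * '<x k.+1, u - x k.+1>
       + '<lam k.+1 - (alpha k * beta k) *: B (W k.+1 - W k), A (u - x k.+1)>)].
Proof.
move=> k1; have a0 := alpha_gt0 k1; have b0 := beta_gt0 k1.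
have e0 := eta_gt0 hmu_f k1.
have [_ xlt xmin] := pds_x halg k1.
have gy : g (y k) \is a fin_num.
  have [[fNy _] _ _ _ _] := hf; have [[gNy _] _ _ _ _] := hg.
  move: xlt; rewrite /x_subproblem /aug_lagr /lagr.
  have := fNy (x k.+1); have := gNy (y k).
  by case: (f _) (g _) => [?| |] [?| |].
have subE u :
    x_subproblem f g A B b mu_f delta gamma alpha beta eps x Zs y Hs lam k u
    = (f u + (fine (g (y k))
      + '<lam1 A B b delta gamma alpha beta x y Hs lam k, A u + (B (y k) - b)>
      + theta delta alpha beta k / 2 * `|A u + (B (y k) - b)| ^+ 2
      + eta delta gamma alpha beta mu_f k / (2 * alpha k * beta k)
        * `|u - xtilde mu_f delta gamma alpha beta x Zs k| ^+ 2
      + eps k / 2 * `|u| ^+ 2)%:E)%E.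
  rewrite /x_subproblem /aug_lagr /lagr -(fineK gy) !addrA.
  by rewrite -!addeA -!EFinD !addrA.
have [] := @subproblem_growth _ _ _ f mu_f A (B (y k) - b)
   (lam1 A B b delta gamma alpha beta x y Hs lam k) (fine (g (y k)))
   (theta delta alpha beta k)
   (eta delta gamma alpha beta mu_f k / (2 * alpha k * beta k)) (eps k)
   (xtilde mu_f delta gamma alpha beta x Zs k) (x k.+1) hA hf.
  split=> //; first by rewrite -subE.
  by move=> u _; rewrite -!subE; exact: xmin.
move=> fx growth; split=> // u fu.
apply: le_trans (growth u fu) _; rewrite lerD2l.
rewrite (prox_term _ _ a0 b0 e0 erefl (pds_Z halg k1)).
have -> : lam1 A B b delta gamma alpha beta x y Hs lam k
    + theta delta alpha beta k *: (A (x k.+1) + (B (y k) - b))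
  = lam k.+1 - (alpha k * beta k) *: B (W k.+1 - W k).
  apply: inner_ext => v; rewrite (pds_lam halg k1).
  rewrite /lam1 /theta /resid /W /Zdelta /Hdelta.
  rewrite (pds_Z halg k1) (pds_H halg k1) !(linopE A, linopE B) !innerE.
  by field; rewrite gt_eqF.
by rewrite le_eqVlt; apply/orP; left; apply/eqP; ring.
Qed.

Variables (xbar : X) (ybar : Y) (lams : Z).
Hypotheses (xbar_fin : f xbar \is a fin_num) (ybar_fin : g ybar \is a fin_num).
Hypothesis bar_feas : A xbar + B ybar = b.
Hypothesis hB_step : forall k, (1 <= k)%N ->
       opnorm B ^+ 2 *
         (alpha k.+1 ^+ 2 * beta k.+1 ^+ 2 - alpha k ^+ 2 * beta k ^+ 2)
       <= alpha k * beta k * mu_g.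

Let gap k := fine (f (x k)) + fine (g (y k)) + '<lams, r k>
  - (fine (f xbar) + fine (g ybar)).

Let excess k := (`|x k| ^+ 2 + `|y k| ^+ 2) - (`|xbar| ^+ 2 + `|ybar| ^+ 2).

Let rest k := (2 * delta)^-1 * (`|U k - xbar| ^+ 2 + `|W k - ybar| ^+ 2)
  + (delta * gamma - 1) / (2 * delta)
    * (`|x k - xbar| ^+ 2 + `|y k - ybar| ^+ 2)
  + 2^-1 * `|lam k - lams| ^+ 2
  + 2^-1 * ((alpha k * beta k) ^+ 2 * `|B (W k - ybar)| ^+ 2).

(** Pays for the change of weight from [(alpha_k beta_k)^2] to its successor in [rest], at the price
    of the strong convexity term of the y-block. If the weight decreases, the left side is
    nonpositive. *)
Lemma B_step k (v : Y) : (1 <= k)%N ->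
  ((alpha k.+1 * beta k.+1) ^+ 2 - (alpha k * beta k) ^+ 2) * `|B v| ^+ 2
  <= alpha k * beta k * mu_g * `|v| ^+ 2.
Proof.
move=> k1; have := hB_step k1; rewrite -!exprMn.
set m := _ - _ => hm.
have [m0|m0] := leP m 0.
  apply: (@le_trans _ _ 0); first by rewrite mulr_le0_ge0 ?sqr_ge0.
  rewrite mulr_ge0 ?sqr_ge0// mulr_ge0// mulr_ge0// ltW ?alpha_gt0 ?beta_gt0//.
have Bv : `|B v| ^+ 2 <= opnorm B ^+ 2 * `|v| ^+ 2.
  rewrite -exprMn lerXn2r// ?nnegrE// ?opnorm_bound//.
  exact: le_trans (opnorm_bound _ hB).
apply: le_trans (ler_wpM2l (ltW m0) Bv) _.
by rewrite mulrA [m * _]mulrC ler_wpM2r// sqr_ge0.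
Qed.

(** Adds the two primal blocks, the dual block, [multiplier_step] paired with [lams], and [B_step].
    The weight on the left stays [(alpha k + delta) * beta k] because the bracket may be negative
    through [excess]. *)
Lemma energy_descent k : (1 <= k)%N ->
  f (x k) \is a fin_num -> g (y k) \is a fin_num ->
  (alpha k + delta) * beta k * (gap k.+1 + eps k / 2 * excess k.+1) + rest k.+1
  <= delta * beta k * (gap k + eps k / 2 * excess k) + rest k.
Proof.
move=> k1 fxk gyk; have a0 := alpha_gt0 k1; have b0 := beta_gt0 k1.
have [_ _ xg] := x_growth k1; have [_ yg] := y_growth k1.
pose Mx d := '<lam k.+1 - (alpha k * beta k) *: B (W k.+1 - W k), A d>.
pose My d := '<lam k.+1, B d>.
have MxL : scalar Mx by move=> a u v; rewrite /Mx linearP innerDr innerZr.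
have MyL : scalar My by move=> a u v; rewrite /My linearP innerDr innerZr.
have hx := primal_block_descent a0 b0 delta_gt0 hdg hmu_f (eps_ge0 k1) MxL
  (pds_Z halg k1) (xg _ xbar_fin) (xg _ fxk).
have hy := primal_block_descent a0 b0 delta_gt0 hdg hmu_g (eps_ge0 k1) MyL
  (pds_H halg k1) (yg _ ybar_fin) (yg _ gyk).
move: hx hy.
rewrite -/(Zdelta delta gamma x Zs k) -/(Zdelta delta gamma x Zs k.+1).
rewrite -/(Hdelta delta gamma y Hs k) -/(Hdelta delta gamma y Hs k.+1).
rewrite -/(U k) -/(U k.+1) -/(W k) -/(W k.+1) => hx hy.
pose v0 := (alpha k * beta k) *: B (W k - ybar).
pose v1 := (alpha k * beta k) *: B (W k.+1 - ybar).
(* Feasibility of [(xbar, ybar)] replaces [b], so that the multiplier terms of the two primal blocks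
   match [dual_block_descent]. *)
have dualE : lam k.+1 - lam k = (alpha k * beta k) *: (A (U k.+1 - xbar)) + v1.
  rewrite (pds_lam halg k1) /v1 -scalerDr addrAC subrr add0r; congr (_ *: _).
  rewrite -bar_feas !linearB /= opprD addrACA; congr (_ + _).
have hd := dual_block_descent (lam k) (lam k.+1) lams v0 v1.
have hdE : '<lam k.+1 - (v1 - v0), (lam k.+1 - lam k) - v1> + '<lam k.+1, v1>
   = alpha k * beta k * Mx (U k.+1 - xbar)
     + alpha k * beta k * My (W k.+1 - ybar).
  rewrite dualE addrK innerZr /Mx /My {2}/v1 innerZr.
  congr (_ * '<_ - _, _> + _).
  by rewrite /v1 /v0 -scalerBr -linearB opprB addrA subrK.
have hmult := congr1 (fun z => '<lams, z>) (multiplier_step k1).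
move: hmult; rewrite !innerDr !innerZr => hmult.
rewrite hdE in hd.
have hv0 : `|v0| ^+ 2 = (alpha k * beta k) ^+ 2 * `|B (W k - ybar)| ^+ 2.
  by rewrite /v0 normrZ exprMn real_normK ?num_real.
have hv1 : `|v1| ^+ 2 = (alpha k * beta k) ^+ 2 * `|B (W k.+1 - ybar)| ^+ 2.
  by rewrite /v1 normrZ exprMn real_normK ?num_real.
rewrite hv0 hv1 in hd.
have hB1 := B_step (W k.+1 - ybar) k1.
have hmu : 0 <= alpha k * beta k * mu_f / 2 * `|U k.+1 - xbar| ^+ 2.
  by rewrite !mulr_ge0 ?sqr_ge0// ltW.
have hlams : '<lams, lam k.+1 - lam k> = '<lams, lam k.+1> + '<lams, - lam k>.
  exact: innerDr.
rewrite hlams in hd; rewrite /rest /gap /excess.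
lra.
Qed.

End Iterates.

(** * Convergence *)

Lemma limn_einf_eq0 {R : realType} (u : nat -> R) :
  (forall n, 0 <= u n) ->
  (forall e, 0 < e -> forall K, exists2 k, (K <= k)%N & u k <= e) ->
  limn_einf (fun n => (u n)%:E) = 0%E.
Proof.
move=> u0 ue; rewrite limn_einf_lim.
suff -> : einfs (fun n => (u n)%:E) = cst 0%E by rewrite lim_cst.
apply/funext => n; apply/eqP; rewrite eq_le; apply/andP; split.
  apply/lee_addgt0Pr => e e0; rewrite add0e.
  have [k nk uk] := ue _ e0 n.
  by apply: ge_ereal_inf; exists (u k)%:E; [exists k|rewrite lee_fin].
by apply: le_ereal_inf_tmp => _ [k _ <-]; rewrite lee_fin.
Qed.

Lemma pnorm_sqr {R : realType} {X Y : hilbertType R} (p : X * Y) :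
  pnorm p ^+ 2 = `|p.1| ^+ 2 + `|p.2| ^+ 2.
Proof. by rewrite /pnorm sqr_sqrtr// addr_ge0 ?sqr_ge0. Qed.

Lemma pnorm_ge0 {R : realType} {X Y : hilbertType R} (p : X * Y) : 0 <= pnorm p.
Proof. exact: sqrtr_ge0. Qed.

Theorem theorem4 (R : realType) (X Y Z : hilbertType R)
    (f : X -> \bar R) (g : Y -> \bar R)
    (A : {linear X -> Z}) (B : {linear Y -> Z}) (b : Z)
    (hA : continuous A) (hB : continuous B)
    (mu_f mu_g delta gamma : R) (alpha beta eps : nat -> R)
    (x Zs : nat -> X) (y Hs : nat -> Y) (lam : nat -> Z)
    (xs : X) (ys : Y) (lams : Z) (xbar : X) (ybar : Y)
    (hmu_f : 0 <= mu_f) (hmu_g : 0 <= mu_g)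
    (hf : S0 mu_f f) (hg : S0 mu_g g)
    (hS : solutions f g A B b !=set0)
    (hbeta_gt0 : forall k, (1 <= k)%N -> 0 < beta k)
    (hbeta_mono : forall k, (1 <= k)%N -> beta k <= beta k.+1)
    (hbeta_lim : beta @ \oo --> +oo)
    (halpha_gt0 : forall k, (1 <= k)%N -> 0 < alpha k)
    (hdelta : 0 < delta) (hgamma : 0 < gamma)
    (hdg : 0 <= delta * gamma - 1)
    (hstep : forall k, (1 <= k)%N ->
       delta * beta k.+1 <= delta * beta k + alpha k * beta k)
    (hB_step : forall k, (1 <= k)%N ->
       opnorm B ^+ 2 *
         (alpha k.+1 ^+ 2 * beta k.+1 ^+ 2 - alpha k ^+ 2 * beta k ^+ 2)
       <= alpha k * beta k * mu_g)
    (halg : pds_algorithm f g A B b mu_f mu_g delta gamma alpha beta eps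
              x Zs y Hs lam)
    (hsaddle : saddle f g A B b xs ys lams)
    (heps_ge0 : forall k, (1 <= k)%N -> 0 <= eps k)
    (heps_mono : forall k, (1 <= k)%N -> eps k.+1 <= eps k)
    (heps_sum : (\sum_(1 <= k <oo) (alpha k * eps k)%:E < +oo)%E)
    (heps_lim : (fun k => beta k * eps k) @ \oo --> +oo)
    (hbar : is_proj (solutions f g A B b) 0 (xbar, ybar)) :
  limn_einf (fun k => (pnorm ((x k, y k) - (xbar, ybar)))%:E) = 0%E /\
  ((exists2 K : nat, (1 <= K)%N &
      let Ball : set (X * Y) :=
        pball 0 (Num.sqrt (`|xbar| ^+ 2 + `|ybar| ^+ 2)) in
      (forall k, (K <= k)%N -> Ball (x k, y k)) \/
      (forall k, (K <= k)%N -> (~` Ball) (x k, y k))) ->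
   (fun k => pnorm ((x k, y k) - (xbar, ybar))) @ \oo --> 0).
Proof.
have [[fNy _] _ flsc fcvx _] := hf; have [[gNy _] _ glsc gcvx _] := hg.
have [psol _] := hbar; have [/= fbar gbar] := solutions_fin fNy gNy psol.
have [/= pfeas _ _] := psol.
(* Indices start at 2: [x 1] is a free starting point, where [f] may be [+oo] and [fine] would
   return a default value. *)
have xfin k : (2 <= k)%N -> f (x k) \is a fin_num.
  case: k => // k k1.
  by have [] := x_growth hA hmu_f hf hg hbeta_gt0 halpha_gt0 hdelta hgamma halg
    k1.
have yfin k : (2 <= k)%N -> g (y k) \is a fin_num.
  case: k => // k k1.
  by have [] := y_growth hB hmu_g hf hg hbeta_gt0 halpha_gt0 hdelta hgamma halg
    k1.
pose r k := A (x k) + B (y k) - b.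
pose phi := fine (f xbar) + fine (g ybar).
pose gap k := fine (f (x k)) + fine (g (y k)) + '<lams, r k> - phi.
pose Nbar := `|xbar| ^+ 2 + `|ybar| ^+ 2.
pose N k := `|x k| ^+ 2 + `|y k| ^+ 2.
pose U k := Zdelta delta gamma x Zs k.
pose W k := Hdelta delta gamma y Hs k.
pose rest0 k := (2 * delta)^-1 * (`|U k - xbar| ^+ 2 + `|W k - ybar| ^+ 2)
  + (delta * gamma - 1) / (2 * delta)
    * (`|x k - xbar| ^+ 2 + `|y k - ybar| ^+ 2).
pose rest1 k := 2^-1 * ((alpha k * beta k) ^+ 2 * `|B (W k - ybar)| ^+ 2).
pose rest k := rest0 k + 2^-1 * `|lam k - lams| ^+ 2 + rest1 k.
have descent k : (2 <= k)%N ->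
    (alpha k + delta) * beta k * (gap k.+1 + eps k / 2 * (N k.+1 - Nbar))
    + rest k.+1
    <= delta * beta k * (gap k + eps k / 2 * (N k - Nbar)) + rest k.
  move=> k2; apply: (@energy_descent _ _ _ _ f g A B b hA hB mu_f mu_g delta
    gamma alpha beta eps x Zs y Hs lam) => //; first exact: ltnW.
  - exact: xfin.
  - exact: yfin.
have gap_ge0 k : (2 <= k)%N -> 0 <= gap k.
  move=> k2; rewrite subr_ge0.
  exact: (saddle_lower_bound fNy gNy hsaddle psol (xfin _ k2) (yfin _ k2)).
have rest0_ge0 k : 0 <= rest0 k.
  rewrite addr_ge0// mulr_ge0 ?addr_ge0 ?sqr_ge0//.
    by rewrite invr_ge0 mulr_ge0// ltW.
  by rewrite divr_ge0// mulr_ge0// ltW.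
have rest1_ge0 k : 0 <= rest1 k.
  by rewrite /rest1 mulr_ge0 ?invr_ge0// mulr_ge0 ?sqr_ge0.
have lam_rest k : 2^-1 * `|lam k - lams| ^+ 2 <= rest k.
  by rewrite /rest -addrA addrCA lerDl addr_ge0.
have rest_ge0 k : 0 <= rest k.
  by apply: le_trans (lam_rest k); rewrite mulr_ge0 ?sqr_ge0.
have N_ge0 k : 0 <= N k by rewrite addr_ge0 ?sqr_ge0.
have Nbar_ge0 : 0 <= Nbar by rewrite addr_ge0 ?sqr_ge0.
have hstep' k : (1 <= k)%N -> delta * beta k.+1 <= (alpha k + delta) * beta k.
  by move=> /hstep; rewrite mulrDl addrC.
(* Passing to [beta k.+1] and [eps k.+1] is monotone only for a nonnegative [h1]. It is used with
   [N], and with [N - Nbar] outside the ball. *)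
have weighted_step k h0 h1 : (1 <= k)%N -> 0 <= gap k.+1 -> 0 <= h1 ->
  (alpha k + delta) * beta k * (gap k.+1 + eps k / 2 * h1) <= h0 ->
  delta * beta k.+1 * (gap k.+1 + eps k.+1 / 2 * h1) <= h0.
  move=> k1 g0 h10; apply: le_trans.
  have e0 := heps_ge0 _ k1; have e1 : 0 <= eps k.+1 by exact: heps_ge0.
  apply: (@le_trans _ _ (delta * beta k.+1 * (gap k.+1 + eps k / 2 * h1))).
    apply: ler_wpM2l.
      by apply: mulr_ge0; apply: ltW => //; exact: hbeta_gt0.
    by rewrite lerD2l ler_wpM2r// ler_wpM2r ?invr_ge0// heps_mono.
  rewrite ler_wpM2r ?hstep'// addr_ge0// mulr_ge0// divr_ge0//.
pose E k := delta * beta k * (gap k + eps k / 2 * N k) + rest k.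
have weighted_gap_ge0 k : (2 <= k)%N -> 0 <= delta * beta k * gap k.
  move=> k2; apply: mulr_ge0; last exact: gap_ge0.
  by apply: mulr_ge0; apply: ltW => //; exact/hbeta_gt0/ltnW.
have tikhonov_ge0 k : (2 <= k)%N -> 0 <= delta * beta k * (eps k / 2 * N k).
  move=> /ltnW k1; apply: mulr_ge0.
    by apply: mulr_ge0; apply: ltW => //; exact: hbeta_gt0.
  by apply: mulr_ge0 => //; rewrite divr_ge0// heps_ge0.
pose S n := \sum_(1 <= k < n) (alpha k * eps k).
have SS k : (1 <= k)%N -> S k.+1 - S k = alpha k * eps k.
  by move=> k1; rewrite /S big_nat_recr//= addrAC subrr add0r.
(* Dropping [- Nbar] from the energy costs [(alpha_k + delta) beta_k - delta beta_k] times
   [eps_k Nbar / 2], that is [alpha_k beta_k eps_k Nbar / 2]. *)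
have Estep k : (2 <= k)%N ->
    E k.+1 <= E k + Nbar / 2 * (beta k * (S k.+1 - S k)).
  move=> k2; have k1 := ltnW k2; rewrite SS// /E.
  rewrite -lerBrDr; apply: weighted_step => //; first exact/gap_ge0/leqW.
  have := descent _ k2; lra.
have Esmall e : 0 < e -> \forall n \near \oo, E n <= e * beta n.
  apply: (@kronecker_little_o _ 2 E beta S (Nbar / 2)) => //.
  - by rewrite divr_ge0.
  - apply: summable_partial_sums => // k k1.
    by rewrite mulr_ge0 ?heps_ge0// ltW ?halpha_gt0.
  - by move=> k /ltnW; exact: hbeta_gt0.
  - by move=> k /ltnW; exact: hbeta_mono.
  - move=> k /ltnW k1; rewrite -subr_ge0 SS//.
    by rewrite mulr_ge0 ?heps_ge0// ltW ?halpha_gt0.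
have gap_small e : 0 < e -> \forall n \near \oo, gap n <= e.
  move=> e0; have := Esmall _ (mulr_gt0 hdelta e0).
  apply: filterS2; last exact: (nbhs_infty_ge 2).
  move=> n n2 En; have b0 := hbeta_gt0 _ (ltnW n2).
  rewrite -(ler_pM2l (mulr_gt0 hdelta b0)) [leRHS]mulrAC; apply: le_trans En.
  have := rest_ge0 n; have := tikhonov_ge0 _ n2; rewrite /E; lra.
have lam_small e : 0 < e -> \forall n \near \oo, `|lam n - lams| <= e * beta n.
  move=> e0; have e2 : 0 < e ^+ 2 / 2 by rewrite divr_gt0// exprn_gt0.
  (* The energy bounds the squared distance by a multiple of [beta n]; [beta n >= 1] allows [beta n]
     to be replaced by its square. *)
  have /cvgryPge/(_ 1) := hbeta_lim.
  apply: filterS3 (nbhs_infty_ge 2) (Esmall _ e2) => n n2 En b1.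
  have b0 := hbeta_gt0 _ (ltnW n2).
  rewrite -ler_sqr ?nnegrE//; last by apply: mulr_ge0; exact: ltW.
  have : 2^-1 * `|lam n - lams| ^+ 2 <= e ^+ 2 / 2 * beta n.
    apply: le_trans (lam_rest n) _; apply: le_trans _ En.
    have := tikhonov_ge0 _ n2; have := weighted_gap_ge0 _ n2; rewrite /E; lra.
  have : e ^+ 2 * beta n <= (e * beta n) ^+ 2.
    by rewrite exprMn ler_wpM2l ?sqr_ge0// expr2 ler_peMl// ltW.
  lra.
have r_small : forall e, 0 < e -> \forall n \near \oo, `|r n| <= e.
  apply: (averaged_multiplier_little_o hdelta hbeta_gt0 halpha_gt0 hbeta_mono
    hbeta_lim hstep' _ lam_small) => k k1.
  exact: (multiplier_step halpha_gt0 halg k1).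
have val_small e : 0 < e ->
    \forall n \near \oo, fine (f (x n)) + fine (g (y n)) <= phi + e.
  move=> e0; have e2 : 0 < e / 2 by rewrite divr_gt0.
  have l1 : 0 < `|lams| + 1 by rewrite ltr_wpDl.
  have er : 0 < e / 2 / (`|lams| + 1) by rewrite divr_gt0.
  apply: filterS2 (gap_small _ e2) (r_small _ er) => n gn.
  rewrite ler_pdivlMr// => rn.
  have := le_trans (ler_norm _) (norm_inner_le lams (- r n)).
  rewrite innerNr normrN; move: gn rn; rewrite /gap.
  have := normr_ge0 (r n); nra.
have close e : 0 < e -> exists2 t, 0 < t & \forall n \near \oo,
    N n <= Nbar + t -> pnorm ((x n, y n) - (xbar, ybar)) <= e.
  move=> e0; have e2 : 0 < e ^+ 2 by rewrite exprn_gt0.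
  have [t t0 wp] := min_norm_well_posed hA hB fNy gNy flsc glsc fcvx gcvx
    hbar (erefl phi) e2.
  exists t => //.
  apply: filterS3 (nbhs_infty_ge 2) (val_small _ t0) (r_small _ t0).
  move=> n n2 vn rn Nn.
  rewrite -ler_sqr ?nnegrE ?pnorm_ge0//; last exact: ltW.
  by rewrite pnorm_sqr; apply: wp => //; [exact: xfin|exact: yfin].
have cvg0 : (forall t, 0 < t -> \forall n \near \oo, N n <= Nbar + t) ->
    (fun k => pnorm ((x k, y k) - (xbar, ybar))) @ \oo --> 0.
  move=> Nt; apply/cvgrPdist_le => e e0; have [t t0 ct] := close _ e0.
  apply: filterS2 ct (Nt _ t0) => n /[apply].
  by rewrite sub0r normrN ger0_norm ?pnorm_ge0.
(* While the iterates stay outside the ball, the Tikhonov term can be kept in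
   the energy, which is then bounded, and [beta * eps] tends to infinity. *)
have outside K : (forall k, (K <= k)%N -> Nbar <= N k) ->
    forall t, 0 < t -> \forall n \near \oo, N n <= Nbar + t.
  move=> KN t t0; pose K2 := maxn K 2.
  have K2l n : (K2 <= n)%N -> (K <= n)%N /\ (2 <= n)%N.
    by rewrite geq_max => /andP.
  pose J k := delta * beta k * (gap k + eps k / 2 * (N k - Nbar)) + rest k.
  have Jle n : (K2 <= n)%N -> J n <= J K2.
    elim: n => [|n IH]; first by rewrite leqn0 => /eqP ->.
    rewrite leq_eqVlt => /predU1P[<-//|]; rewrite ltnS => Kn.
    have [Kn1 n2] := K2l _ Kn; apply: le_trans (IH Kn).
    rewrite /J -lerBrDr; apply: weighted_step; first exact: ltnW.
    - exact/gap_ge0/leqW.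
    - by rewrite subr_ge0 KN// leqW.
    - have := descent _ n2; rewrite /J; lra.
  have dt : 0 < delta * t / 2 by rewrite divr_gt0// mulr_gt0.
  (* From [delta beta_n eps_n / 2 * (N n - Nbar) <= J n <= J K2], this size of [beta n * eps n]
     forces [N n - Nbar <= t]; the [+ 1] keeps the product positive. *)
  have /cvgryPge/(_ (`|J K2| / (delta * t / 2) + 1)) := heps_lim.
  apply: filterS2 (nbhs_infty_ge K2) => n Kn be; have [Kn1 n2] := K2l _ Kn.
  have be1 : `|J K2| / (delta * t / 2) <= beta n * eps n by lra.
  have be0 : 0 < beta n * eps n.
    by apply: lt_le_trans be; rewrite ltr_wpDl// divr_ge0// ltW.
  rewrite ler_pdivrMr// in be1.
  have Jn : delta * (beta n * eps n) / 2 * (N n - Nbar) <= `|J K2|.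
    apply: le_trans (ler_norm _); apply: le_trans (Jle _ Kn).
    have := rest_ge0 n; have := weighted_gap_ge0 _ n2; rewrite /J; lra.
  have dbe : 0 < delta * (beta n * eps n) / 2 by rewrite divr_gt0// mulr_gt0.
  rewrite -lerBlDl -(ler_pM2l dbe); apply: le_trans Jn _; apply: le_trans be1 _.
  rewrite le_eqVlt; apply/orP; left; apply/eqP; ring.
have ballE k : pball (0 : X * Y) (Num.sqrt Nbar) (x k, y k) <-> N k < Nbar.
  rewrite /pball/= subr0 /pnorm /= -/(N k).
  have [lt_sqrt|ge_sqrt] := ltP (N k) Nbar.
    by split=> // _; rewrite ltr_sqrt// (le_lt_trans _ lt_sqrt).
  by split=> //; rewrite ltNge ler_wsqrtr.
split.
  apply: limn_einf_eq0 => [n|e e0 K]; first exact: pnorm_ge0.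
  (* Either the iterates are eventually outside the ball and the whole sequence converges, or they
     enter it infinitely often, and at those indices [N k < Nbar] is all that [close] asks for. *)
  have [[K' KN]|noK] :=
    pselect (exists K', forall k, (K' <= k)%N -> Nbar <= N k).
    have /cvgrPdist_le/(_ e e0) := cvg0 (outside _ KN).
    move=> [M _ Mn]; exists (maxn K M); first exact: leq_maxl.
    have := Mn _ (leq_maxr K M); rewrite /= sub0r normrN.
    by rewrite ger0_norm ?pnorm_ge0.
  have [t t0 [M _ Mn]] := close _ e0.
  have [k Kk Nk] : exists2 k, (maxn K M <= k)%N & N k < Nbar.
    apply: contrapT => noex; apply: noK; exists (maxn K M) => k Kk.
    by rewrite leNgt; apply/negP => Nk; apply: noex; exists k.
  move: Kk; rewrite geq_max => /andP[Kk Mk]; exists k => //.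
  by apply: (Mn k Mk); rewrite ltW// ltr_wpDr// ltW.
move=> [K K1 /= [inb|outb]]; apply: cvg0.
  move=> t t0; exists K => // n /= Kn.
  by rewrite ltW// ltr_wpDr ?ltW//; apply/ballE/inb.
by apply: (outside K) => k Kk; rewrite leNgt; apply/negP => /ballE; exact: outb.
Qed.
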